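(* Consider $K$ tiers of satellites, tier $k$ consisting of $N_k$ satellites placed independently and uniformly on the sphere of radius $R_k$, with tier $m$ legitimate and tiers $k\ne m$ eavesdropping. For the $j$-th satellite of tier $k\ne m$ with central angle $\theta_{kj}$ to the typical device at $(0,0,R_\oplus)$ and distance $d_{kj,0}=\sqrt{R_\oplus^2+R_k^2-2R_\oplus R_k\cos\theta_{kj}}$, define (when $\theta_{kj}<\theta_{k,\max}$) $$\mathrm{SINR}_{kj}=\frac{\gamma P_{\rm rec}(d_{kj,0})}{(1-\gamma)P_{\rm rec}(d_{kj,0})+\mathcal{I}_{kj}+\sigma_S^2},\qquad P_{\rm rec}(d)=P_t\left(\frac{c}{4\pi f d}\right)^2G|h_{kj,0}|^2,$$ and set $\mathrm{SINR}_{kj}=0$ when $\theta_{kj}\ge\theta_{k,\max}$ (not visible). Assume: $m_1$ is a positive integer; $0<\beta_{\rm ES}<\gamma/(1-\gamma)$ (any $\beta_{\rm ES}>0$ if $\gamma=1$); the events $\{\mathrm{SINR}_{kj}<\beta_{\rm ES}\}$ are mutually independent over all $k\ne m$ and $j$; $|h_{kj,0}|^2$ is independent of $(\theta_{kj},\mathcal{I}_{kj})$ with CDF $F(x)=\left[1-\exp\!\left(-\frac{(m_1!)^{-1/m_1}}{m_2}x\right)\right]^{m_1}$; and conditionally on $\theta_{kj}$, $\mathcal{I}_{kj}$ has Laplace transform $$\mathcal{L}_{\mathcal{I}_{kj}}(s)=\exp\!\left(-\lambda_u\int_0^{2\pi}\!\!\int_0^{\theta_{k,\max}}\left[1-\left(1+m_2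 s P_t G\left(\frac{c}{4\pi f d_k(\vartheta)}\right)^2\right)^{-m_1}\right]R_\oplus^2\sin\vartheta\,d\vartheta\,d\varphi\right),$$ $d_k(\vartheta)=\sqrt{R_\oplus^2+R_k^2-2R_\oplus R_k\cos\vartheta}$. Then $$\mathcal{P}_{\rm out}=\mathbb{P}\left[\max_{k\ne m}\max_{j}\mathrm{SINR}_{kj}<\beta_{\rm ES}\right]=\prod_{k=1,k\ne m}^{K}\left[\sum_{q=0}^{m_1}\binom{m_1}{q}(-1)^q\int_0^{\theta_{k,\max}}\exp\!\left(-q s_{\rm ES}\sigma_S^2\right)\mathcal{L}_{\mathcal{I}_{kj}}(q s_{\rm ES})\frac{\sin\theta}{2}\,d\theta+\frac{1+\cos\theta_{k,\max}}{2}\right]^{N_k},$$ where $s_{\rm ES}=s_{\rm ES}(\theta)=\frac{(m_1!)^{-1/m_1}}{m_2}\frac{\beta_{\rm ES}}{[\gamma-\beta_{\rm ES}(1-\gamma)]P_tG}\left(\frac{4\pi f d_k(\theta)}{c}\right)^2$.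
   Context: $R_\oplus$ is the Earth radius and $R_k=R_\oplus+a_k>R_\oplus$ with $a_k$ the altitude of tier $k$; $\gamma\in(0,1]$ is the fraction of transmit power $P_t>0$ carrying information, the remaining $(1-\gamma)P_t$ being artificial noise which eavesdroppers cannot remove; $G>0$ antenna gain; $c$ speed of light; $f>0$ carrier frequency; $\sigma_S^2>0$ noise power; $\lambda_u$ density of the Poisson point process of interfering devices on the Earth sphere; $m_1,m_2>0$ fading parameters. Given a half beamwidth angle $\theta_{\rm beam}\in(0,\pi/2)$, $$\theta_{k,\max}=\begin{cases}\sin^{-1}\!\left(\frac{R_k}{R_\oplus}\sin\theta_{\rm beam}\right)-\theta_{\rm beam}, & \theta_{\rm beam}<\sin^{-1}\!\left(\frac{R_\oplus}{R_k}\right),\\[2pt] \cos^{-1}\!\left(\frac{R_\oplus}{R_k}\right), & \theta_{\rm beam}\ge \sin^{-1}\!\left(\frac{R_\oplus}{R_k}\right).\end{cases}$$ The central angle of a single uniformly placed satellite to the typical device has density $\frac{\sin\theta}{2}$ on $[0,\pi]$. *)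

(* Defs.v *)
From HB Require Import structures.
From mathcomp Require Import all_boot all_order all_algebra.
From mathcomp Require Import all_classical all_reals all_analysis.
Set Implicit Arguments. Unset Strict Implicit. Unset Printing Implicit Defensive.
Import Order.TTheory GRing.Theory Num.Theory.
Local Open Scope classical_set_scope.
Local Open Scope ring_scope.

Section Defs.
Variable R : realType.

Definition theta_max (Re Rk theta_beam : R) : R :=
  if theta_beam < asin (Re / Rk)
  then asin (Rk / Re * sin theta_beam) - theta_beam
  else acos (Re / Rk).

Definition dist_k (Re Rk theta : R) : R :=
  Num.sqrt (Re ^+ 2 + Rk ^+ 2 - 2 * Re * Rk * cos theta).

Definition Prec (Pt c f G d h2 : R) : R :=
  Pt * (c / (4 * pi * f * d)) ^+ 2 * G * h2.

Definition SINR (Re Rk theta_beam gamma Pt c f G sigma2 : R)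
  (theta I h2 : R) : R :=
  if theta < theta_max Re Rk theta_beam then
    let P := Prec Pt c f G (dist_k Re Rk theta) h2 in
    gamma * P / ((1 - gamma) * P + I + sigma2)
  else 0.

Definition Fh (m1 : nat) (m2 x : R) : R :=
  (1 - expR (- ((m1`!%:R) `^ (- (m1%:R)^-1) / m2 * x))) ^+ m1.

Definition LapI (m1 : nat) (Re Rk theta_beam lambda_u m2 Pt G c f : R) (s : R) : R :=
  expR (- lambda_u *
    Rintegral (@lebesgue_measure R) `[0, 2 * pi] (fun _ : R =>
      Rintegral (@lebesgue_measure R) `[0, theta_max Re Rk theta_beam]
        (fun v => (1 - (1 + m2 * s * Pt * G *
                         (c / (4 * pi * f * dist_k Re Rk v)) ^+ 2) ^-1 ^+ m1)
                  * Re ^+ 2 * sin v))).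

Definition s_ES (m1 : nat) (Re Rk m2 beta gamma Pt G c f theta : R) : R :=
  (m1`!%:R) `^ (- (m1%:R)^-1) / m2 * beta /
    ((gamma - beta * (1 - gamma)) * Pt * G) *
    (4 * pi * f * dist_k Re Rk theta / c) ^+ 2.

Definition pr d (T : measurableType d) (P : probability T R) (A : set T) : R :=
  fine (P A).

Definition mutually_independent d (T : measurableType d) (P : probability T R)
  (I : eqType) (D : I -> Prop) (E : I -> set T) : Prop :=
  forall s : seq I, uniq s -> (forall i, i \in s -> D i) ->
    pr P (\big[setI/setT]_(i <- s) E i) = \prod_(i <- s) pr P (E i).

Definition indep_RV_pair d (T : measurableType d) (P : probability T R)
  (X Y Z : T -> R) : Prop :=
  forall (A : set R) (B : set (R * R)%type), measurable A -> measurable B ->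
    pr P (X @^-1` A `&` (fun t => (Y t, Z t)) @^-1` B) =
    pr P (X @^-1` A) * pr P ((fun t => (Y t, Z t)) @^-1` B).

End Defs.

(* Main.v *)
(** A single satellite violates the threshold exactly when it is visible and
    its fading power reaches [s_ES theta * (I + sigma2) / alpha], where [alpha]
    is the rate in the cdf of the fading power.  Integrating out the fading
    first, by independence, turns the probability of staying below into the
    expectation of [(1 - exp (- s_ES theta * (I + sigma2))) ^ m1]; the binomial
    expansion reduces it to expectations of [exp (- q s_ES theta * (I + sigma2))].
    The interference has the same Laplace transform conditionally on every event
    [theta \in A], which gives these expectations when [s_ES] is replaced by a
    simple function of [theta], and in general by dominated convergence.
    Mutual independence then yields the product over the satellites. *)
Require Import Defs.
From HB Require Import structures.
From mathcomp Require Import all_boot all_order all_algebra.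
From mathcomp Require Import all_classical all_reals all_analysis.
From mathcomp Require Import measurable_realfun.
Import Order.TTheory GRing.Theory Num.Theory.
Import numFieldNormedType.Exports HBNNSimple.
From mathcomp Require Import ring lra.
Local Open Scope classical_set_scope.
Local Open Scope ring_scope.

(** * Independence and integration tools *)

Lemma pr_EFin {R : realType} {d} {T : measurableType d} (P : probability T R)
  (A : set T) : measurable A -> (pr P A)%:E = P A.
Proof. by move=> mA; rewrite /pr fineK// fin_num_measure. Qed.

(** By independence, the joint law of [((Y, Z), X)] and the product of the laws of [(Y, Z)] and [X]
    agree on rectangles, hence everywhere by uniqueness of the product measure. The product measure
    of [S] is the integral of its sections. *)
Lemma indep_RV_pair_sections {R : realType} {d} {T : measurableType d}
  (P : probability T R) (X Y Z : T -> R)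
  (mX : measurable_fun setT X) (mY : measurable_fun setT Y)
  (mZ : measurable_fun setT Z) :
  indep_RV_pair P X Y Z -> forall S : set ((R * R) * R), measurable S ->
  P ((fun t => ((Y t, Z t), X t)) @^-1` S) =
  (\int[P]_t P (X @^-1` xsection S (Y t, Z t)))%E.
Proof.
move=> iXYZ S mS.
have mYZ : measurable_fun setT (fun t => (Y t, Z t)) by exact: measurable_fun_pair.
have mYZX : measurable_fun setT (fun t => ((Y t, Z t), X t)).
  exact: measurable_fun_pair.
pose V : {mfun T >-> (R * R)%type} := HB.pack (fun t => (Y t, Z t))
  (isMeasurableFun.Build _ _ _ _ _ mYZ).
pose U : {mfun T >-> R} := HB.pack X (isMeasurableFun.Build _ _ _ _ _ mX).
pose W : {mfun T >-> ((R * R) * R)%type} :=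
  HB.pack (fun t => ((Y t, Z t), X t)) (isMeasurableFun.Build _ _ _ _ _ mYZX).
transitivity (distribution P W S) => //.
rewrite -(@product_measure_unique _ _ _ _ R (distribution P V) (distribution P U)
  (distribution P W) _ S mS).
  rewrite /product_measure1 ge0_integral_pushforward//.
  exact: measurable_fun_xsection.
move=> A B mA mB.
have mVA : measurable (V @^-1` A) by rewrite -[X in measurable X]setTI; exact: (mYZ measurableT).
have mUB : measurable (U @^-1` B) by rewrite -[X in measurable X]setTI; exact: (mX measurableT).
transitivity (P (U @^-1` B `&` V @^-1` A)); first by rewrite setIC.
rewrite -(pr_EFin P (U @^-1` B `&` V @^-1` A)); last exact: measurableI.
by rewrite iXYZ// EFinM ![(pr _ _)%:E]pr_EFin// muleC.
Qed.

(** Allows a function with finitely many values to be treated as a constant on each of its level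
    sets. At a point [x] only the summand with [r = u x] can be nonzero. *)
Lemma ge0_integral_levels {R : realType} {d} {T : measurableType d}
  (mu : {measure set T -> \bar R}) (D : set T) (u : T -> R) (V : set R)
  (f : T -> \bar R) : measurable D -> measurable_fun setT u -> finite_set V ->
  (forall x, V (u x)) -> measurable_fun setT f -> (forall x, (0 <= f x)%E) ->
  (\int[mu]_(x in D) f x =
   \sum_(r \in V) \int[mu]_(x in D `&` u @^-1` [set r]) f x)%E.
Proof.
move=> mD mu' fV Vu mf f0.
have mur r : measurable (u @^-1` [set r]).
  by rewrite -[X in measurable X]setTI; exact: mu'.
under eq_fsbigr do rewrite integral_mkcondr.
rewrite -ge0_integral_fsum//; first last.
- by move=> r x Dx; rewrite patchE; case: ifP.
- move=> r; apply/(measurable_restrict _ _ _) => //.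
  by apply: measurable_funS mf.
apply: eq_integral => x _.
rewrite (fsbigD1 (u x))//=.
rewrite patchE ifT ?inE//= fsbig1 ?adde0// => r [_ /= rux].
by rewrite patchE ifF//; apply/negbTE; rewrite notin_setE /= => /esym.
Qed.

Lemma dominated_cvg_integral {R : realType} {d} {T : measurableType d}
  (mu : {measure set T -> \bar R}) (D : set T) (f_ : nat -> T -> R)
  (f g : T -> R) : measurable D ->
  (forall n, measurable_fun D (f_ n)) ->
  (forall x, D x -> f_ ^~ x @ \oo --> f x) ->
  mu.-integrable D (EFin \o g) ->
  (forall n x, D x -> `|f_ n x| <= g x) ->
  (\int[mu]_(x in D) (f_ n x)%:E @[n --> \oo] --> \int[mu]_(x in D) (f x)%:E)%E.
Proof.
move=> mD mf cf ig fg.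
have [] := @dominated_convergence _ _ _ mu D mD (fun n x => (f_ n x)%:E)
   (fun x => (f x)%:E) (EFin \o g).
- by move=> n; apply/measurable_EFinP.
- apply/measurable_EFinP; apply: (measurable_fun_cvg (h := f_)) => //.
- by apply: aeW => x Dx; apply: cvg_EFin; [exact: nearW|exact: cf].
- by [].
- by apply: aeW => x n Dx; rewrite /= lee_fin fg.
- by [].
Qed.

(** * Laplace transforms of nonnegative random variables *)

Definition laplace {R : realType} {d} {T : measurableType d}
  (P : probability T R) (Y : T -> R) (s : R) : R :=
  \int[P]_t expR (- (s * Y t)).

Lemma expRN_ge0_le1 {R : realType} (x : R) : 0 <= x -> `|expR (- x)| <= 1.
Proof. by move=> x0; rewrite ger0_norm ?expR_ge0// -expR0 ler_expR oppr_le0. Qed.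

Lemma measurable_expRN {R : realType} {d} {T : measurableType d}
  (D : set T) (f : T -> R) : measurable_fun setT f ->
  measurable_fun D (fun t => expR (- f t)).
Proof.
move=> mf; apply: (measurable_funS (E := setT)) => //.
by apply: measurableT_comp => //; exact: measurableT_comp.
Qed.

Lemma bounded1_integrable {R : realType} {d} {T : measurableType d}
  (P : probability T R) (D : set T) (f : T -> R) : measurable D ->
  measurable_fun D f -> (forall t, `|f t| <= 1) -> P.-integrable D (EFin \o f).
Proof.
move=> mD mf f1; apply: measurable_bounded_integrable => //.
  by rewrite (le_lt_trans (probability_le1 P mD))// ltry.
exists 1; split=> // M M1 t _ /=.
by rewrite (le_trans (f1 t))// ltW.
Qed.

Lemma laplace_EFin {R : realType} {d} {T : measurableType d}
  (P : probability T R) (Y : T -> R) (s : R) : measurable_fun setT Y ->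
  (forall t, 0 <= Y t) -> 0 <= s ->
  (laplace P Y s)%:E = (\int[P]_t (expR (- (s * Y t)))%:E)%E.
Proof.
move=> mY Y0 s0; rewrite /laplace /Rintegral fineK//.
apply: integrable_fin_num => //.
apply: bounded1_integrable => //.
  by apply: measurable_expRN; exact: measurable_funM.
by move=> t; rewrite expRN_ge0_le1// mulr_ge0.
Qed.

Lemma laplace_ge0 {R : realType} {d} {T : measurableType d}
  (P : probability T R) (Y : T -> R) (s : R) : 0 <= laplace P Y s.
Proof. by apply: Rintegral_ge0 => t _; exact: expR_ge0. Qed.

Lemma laplace_le1 {R : realType} {d} {T : measurableType d}
  (P : probability T R) (Y : T -> R) (s : R) : measurable_fun setT Y ->
  (forall t, 0 <= Y t) -> 0 <= s -> laplace P Y s <= 1.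
Proof.
move=> mY Y0 s0; rewrite -lee_fin laplace_EFin// -(@probability_setT _ _ _ P).
rewrite -[leRHS]mul1e -integral_cst//; apply: ge0_le_integral => //.
- by apply/measurable_EFinP/measurable_expRN; exact: measurable_funM.
- move=> t _; rewrite lee_fin -[leRHS]expR0 ler_expR oppr_le0 mulr_ge0//.
Qed.

(** For nonnegative arguments all integrands are dominated by the constant 1, which is integrable
    for a probability. *)
Lemma cvg_laplace {R : realType} {d} {T : measurableType d}
  (P : probability T R) (Y : T -> R) (s_ : nat -> R) (s : R) :
  measurable_fun setT Y -> (forall t, 0 <= Y t) ->
  (forall n, 0 <= s_ n) -> s_ @ \oo --> s ->
  laplace P Y (s_ n) @[n --> \oo] --> laplace P Y s.
Proof.
move=> mY Y0 s_0 s_s.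
have s0 : 0 <= s.
  by rewrite -(cvg_lim _ s_s)//; apply: limr_ge; [exact: cvgP s_s|exact: nearW].
apply: fine_cvg; rewrite -/(laplace P Y s) laplace_EFin//.
apply: (dominated_cvg_integral P setT (fun n t => expR (- (s_ n * Y t))) _ (cst 1)) => //.
- by move=> n; apply: measurable_expRN; exact: measurable_funM.
- move=> t _; apply: continuous_cvg; first exact: continuous_expR.
  by apply: cvgN; apply: cvgMl.
- exact: finite_measure_integrable_cst.
- by move=> n t _; rewrite expRN_ge0_le1// mulr_ge0.
Qed.

(** The composite is a partial integral of a nonnegative jointly measurable function of [(x, t)], so
    Tonelli applies. *)
Lemma measurable_laplace_comp {R : realType} {d d'} {T : measurableType d}
  {E : measurableType d'} (P : probability T R) (Y : T -> R) (psi : E -> R) :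
  measurable_fun setT Y -> (forall t, 0 <= Y t) ->
  measurable_fun setT psi -> (forall x, 0 <= psi x) ->
  measurable_fun setT (fun x => laplace P Y (psi x)).
Proof.
move=> mY Y0 mpsi psi0; apply/measurable_EFinP.
rewrite (_ : _ \o _ = fun x => (\int[P]_t (expR (- (psi x * Y t)))%:E)%E); last first.
  by apply/funext => x /=; rewrite laplace_EFin.
apply: (@measurable_fun_fubini_tonelli_F _ _ E T R P
  (fun xt => (expR (- (psi xt.1 * Y xt.2)))%:E)) => //.
- apply/measurable_EFinP/measurable_expRN; apply: measurable_funM.
    by apply: measurableT_comp => //.
  by apply: measurableT_comp.
Qed.

(** In the hypothesis the Laplace variable [s] is a constant, whereas the threshold of a satellite
    depends on its own angle; this lemma lets the variable be a function [psi] of [X]. *)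
Lemma laplace_mixture {R : realType} {d d'} {T : measurableType d}
  {E : measurableType d'} (P : probability T R) (mu : {measure set E -> \bar R})
  (D : set E) (w : E -> R) (X : T -> E) (Y : T -> R) :
  measurable D -> measurable_fun setT X -> measurable_fun setT Y ->
  (forall t, 0 <= Y t) -> (forall x, D x -> 0 <= w x) ->
  mu.-integrable D (EFin \o w) ->
  (forall s A, 0 <= s -> measurable A ->
    (\int[P]_(t in X @^-1` A) (expR (- (s * Y t)))%:E =
     (laplace P Y s)%:E * \int[mu]_(x in A `&` D) (w x)%:E)%E) ->
  forall (psi : E -> R) (B : set E), measurable_fun setT psi ->
  (forall x, 0 <= psi x) -> measurable B ->
  (\int[P]_(t in X @^-1` B) (expR (- (psi (X t) * Y t)))%:E =
   \int[mu]_(x in B `&` D) (laplace P Y (psi x) * w x)%:E)%E.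
Proof.
move=> mD mX mY Y0 w0 iw hA psi B mpsi psi0 mB.
have mXA A : measurable A -> measurable (X @^-1` A).
  by move=> mA; rewrite -[X in measurable X]setTI; exact: mX.
have mw : measurable_fun D w by case/integrableP : iw => /measurable_EFinP.
have mBD : measurable (B `&` D) by exact: measurableI.
pose psi_ := nnsfun_approx measurableT (proj2 (measurable_EFinP setT psi) mpsi).
have psi_psi x : psi_ ^~ x @ \oo --> psi x.
  have /fine_cvg : (EFin \o psi_ ^~ x @ \oo --> (psi x)%:E)%E.
    by apply: cvg_nnsfun_approx => // y _; rewrite lee_fin.
  by [].
(* For a simple [psi_ n], both sides are cut along its level sets, on each of which the hypothesis
   with constant [s] applies. *)
have eq_n n : (\int[P]_(t in X @^-1` B) (expR (- (psi_ n (X t) * Y t)))%:E =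
   \int[mu]_(x in B `&` D) (laplace P Y (psi_ n x) * w x)%:E)%E.
  have mpn : measurable_fun setT (psi_ n) by exact: measurable_funP.
  have pn0 x : 0 <= psi_ n x by exact: fun_ge0.
  have mlev r : measurable (psi_ n @^-1` [set r]).
    by rewrite -[X in measurable X]setTI; exact: mpn.
  have psiV x : range (psi_ n) (psi_ n x) by exists x.
  rewrite (ge0_integral_levels _ _ (psi_ n \o X) (range (psi_ n)))//; first last.
  - apply/measurable_EFinP/measurable_expRN; apply: measurable_funM => //.
    exact: measurableT_comp.
  - exact: measurableT_comp.
  - exact: mXA.
  rewrite [RHS]integral_mkcondr.
  rewrite (ge0_integral_levels _ _ (psi_ n) (range (psi_ n)))//; first last.
  - move=> x; rewrite patchE; case: ifPn => // /set_mem Dx.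
    by rewrite lee_fin mulr_ge0 ?laplace_ge0 ?w0.
  - apply/(measurable_restrictT _ mD); apply/measurable_EFinP.
    apply: measurable_funM => //; apply: measurable_funTS.
    exact: measurable_laplace_comp.
  (* Only attained values [r] occur, which gives the sign condition that [hA] requires. *)
  apply: eq_fsbigr => r /set_mem [x0 _ rE].
  have r0 : 0 <= r by rewrite -rE.
  rewrite -integral_mkcondr.
  transitivity (\int[P]_(t in X @^-1` (B `&` psi_ n @^-1` [set r]))
      (expR (- (r * Y t)))%:E)%E.
    by apply: eq_integral => t /set_mem[_ /= ->].
  rewrite hA//.
  have mBrD : measurable (B `&` psi_ n @^-1` [set r] `&` D).
    by do 2 apply: measurableI => //.
  transitivity (\int[mu]_(x in B `&` psi_ n @^-1` [set r] `&` D)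
      ((laplace P Y r)%:E * (w x)%:E))%E.
    apply/esym; apply: ge0_integralZl_EFin => //.
    - by move=> x [_ Dx]; rewrite lee_fin w0.
    - by apply/measurable_EFinP; apply: measurable_funS mw => // x [].
    - exact: laplace_ge0.
  by apply: eq_integral => x /set_mem[[_ /= ->] _]; rewrite EFinM.
have cL : (\int[P]_(t in X @^-1` B) (expR (- (psi_ n (X t) * Y t)))%:E @[n --> \oo]
    --> \int[P]_(t in X @^-1` B) (expR (- (psi (X t) * Y t)))%:E)%E.
  apply: (dominated_cvg_integral P _
    (fun n t => expR (- (psi_ n (X t) * Y t))) _ (cst 1)) => //.
  - exact: mXA.
  - move=> n; apply: measurable_expRN; apply: measurable_funM => //.
    by apply: measurableT_comp => //; exact: measurable_funP.
  - move=> t _; apply: continuous_cvg; first exact: continuous_expR.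
    by apply: cvgN; apply: cvgMl; exact: psi_psi.
  - by apply: finite_measure_integrable_cst; exact: mXA.
  - by move=> n t _; rewrite expRN_ge0_le1// mulr_ge0.
apply: (cvg_unique _ cL) => //.
rewrite (funext eq_n).
(* The dominating function is [w] itself, since the Laplace transforms lie between 0 and 1. *)
apply: (dominated_cvg_integral mu _
    (fun n x => laplace P Y (psi_ n x) * w x) _ w) => //.
- move=> n; apply: measurable_funM; last by apply: measurable_funS mw => // x [].
  by apply: measurable_funTS; apply: measurable_laplace_comp => //; exact: measurable_funP.
- move=> x _; apply: cvgMl; apply: cvg_laplace => //.
- by apply: integrableS iw => // x [].
- move=> n x [_ Dx]; rewrite normrM ger0_norm ?laplace_ge0// ger0_norm ?w0//.
  by rewrite ler_piMl ?w0// laplace_le1.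
Qed.

(** * The fading power and its distribution function *)

Lemma probability_lt_of_continuous_cdf {R : realType} {d}
  {T : measurableType d} (P : probability T R) (h : T -> R) (F : R -> R) (v : R) :
  measurable_fun setT h -> continuous F -> 0 < v ->
  (forall x, 0 <= x -> pr P (h @^-1` `]-oo, x]) = F x) ->
  P [set t | h t < v] = (F v)%:E.
Proof.
move=> mh cF v0 hF.
have mlt x : measurable [set t | h t < x].
  have := mh measurableT `]-oo, x[%classic (measurable_itv _).
  by rewrite setTI; congr measurable; apply/seteqP; split=> t /=; rewrite in_itv.
have mle x : measurable (h @^-1` `]-oo, x]).
  by rewrite -[X in measurable X]setTI; exact: mh.
rewrite -pr_EFin//; congr EFin; apply/eqP; rewrite eq_le; apply/andP; split.
  rewrite -(hF v (ltW v0)) -lee_fin !pr_EFin//.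
  by apply: le_measure; rewrite ?inE// => t /=; rewrite in_itv /= => /ltW.
(* Lower bound: for small [x > 0] the event [h <= v - x] lies in [h < v], and [F (v - x)] tends to
   [F v]. Taking [x <= v] keeps the argument in the range where [F] is known to be the cdf. *)
have Fv : F (v - x) @[x --> 0^'+] --> F v.
  rewrite -[in X in _ --> X](subr0 v).
  apply: (@cvg_at_right_filter _ _ (fun x => F (v - x)) 0).
  apply: (@continuous_comp _ _ _ (fun x => v - x) F); last exact: cF.
  by apply: cvgB; [exact: cvg_cst|exact: cvg_id].
rewrite -(cvg_lim _ Fv)//; apply: limr_le; first exact: cvgP Fv.
near=> x.
rewrite -hF ?subr_ge0//; last by near: x; exact: nbhs_right_le.
rewrite -lee_fin !pr_EFin//.
apply: le_measure; rewrite ?inE// => t /=; rewrite in_itv /= => /le_lt_trans; apply.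
by rewrite gtrBl.
Unshelve. all: by end_near.
Qed.

Lemma continuous_exp_cdf {R : realType} (alpha : R) (n : nat) :
  continuous (fun x : R => (1 - expR (- (alpha * x))) ^+ n).
Proof.
move=> x; apply: (@continuous_comp _ _ _ (fun x => 1 - expR (- (alpha * x)))
  (fun y : R => y ^+ n)); last exact: exprn_continuous.
apply: cvgB; first exact: cvg_cst.
apply: continuous_cvg; first exact: continuous_expR.
by apply: cvgN; apply: cvgMr; exact: cvg_id.
Qed.

(** Dividing the threshold by [alpha] cancels the rate of the fading cdf. The set [B] stands for the
    visible positions, and the noise is absorbed into the variable [I + sigma]. The case [r = 0] of
    the Laplace hypothesis says that [X] has density [w] on [D] with respect to [mu]. *)
Lemma fading_outage {R : realType} {d} {T : measurableType d}
  (P : probability T R) (h X I : T -> R) (mu : {measure set (measurableTypeR R) -> \bar R})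
  (D B : set R) (w s : R -> R) (alpha sigma : R) (n : nat) :
  measurable_fun setT h -> measurable_fun setT X -> measurable_fun setT I ->
  indep_RV_pair P h X I ->
  0 < alpha -> 0 < sigma -> (forall t, 0 <= I t) ->
  (forall x, 0 <= x ->
     pr P (h @^-1` `]-oo, x]) = (1 - expR (- (alpha * x))) ^+ n) ->
  measurable D -> (forall x, D x -> 0 <= w x) -> mu.-integrable D (EFin \o w) ->
  (forall r A, 0 <= r -> measurable A ->
    (\int[P]_(t in X @^-1` A) (expR (- (r * (I t + sigma))))%:E =
     (laplace P (fun t => I t + sigma) r)%:E *
       \int[mu]_(x in A `&` D) (w x)%:E)%E) ->
  measurable_fun setT s -> (forall x, 0 < s x) -> measurable B ->
  P [set t | B (X t) /\ h t < s (X t) * (I t + sigma) / alpha] =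
  (\sum_(q < n.+1) ('C(n, q)%:R * (-1) ^+ q)%:E *
     \int[mu]_(x in B `&` D)
       (laplace P (fun t => I t + sigma) (q%:R * s x) * w x)%:E)%E.
Proof.
move=> mh mX mI ihXI alpha0 sigma0 I0 hF mD w0 iw hL ms s0 mB.
have mXB : measurable (X @^-1` B) by rewrite -[Z in measurable Z]setTI; exact: mX.
have mY : measurable_fun setT (fun t => I t + sigma) by exact: measurable_funD.
have Y0 t : 0 < I t + sigma by rewrite ltr_wpDl.
(* The section of [S] at [(X t, I t)] is a sublevel set of the fading power if [X t] lies in [B],
   and empty otherwise. *)
pose S : set ((R * R) * R) := [set z | B z.1.1 /\
  z.2 < s z.1.1 * (z.1.2 + sigma) / alpha].
have mS : measurable S.
  have m11 : measurable_fun setT (fun z : (R * R) * R => z.1.1).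
    exact: measurableT_comp.
  have -> : S = (fun z : (R * R) * R => z.1.1) @^-1` B `&`
      (fun z : (R * R) * R => z.2 < s z.1.1 * (z.1.2 + sigma) / alpha) @^-1` [set true].
    by apply/seteqP; split.
  apply: measurableI; first by rewrite -[Z in measurable Z]setTI; exact: m11.
  rewrite -[Z in measurable Z]setTI; apply: measurable_fun_ltr => //.
  apply: measurable_funM => //; apply: measurable_funM.
    exact: measurableT_comp.
  by apply: measurable_funD => //; exact: measurableT_comp.
rewrite (_ : [set t | _] = (fun t => ((X t, I t), h t)) @^-1` S)//.
rewrite (indep_RV_pair_sections _ _ _ _ mh mX mI ihXI _ mS).
pose e q t := expR (- (q%:R * s (X t) * (I t + sigma))).
have me q : measurable_fun setT (e q).
  apply: measurable_expRN; apply: measurable_funM => //.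
  by apply: measurable_funM => //; exact: measurableT_comp.
have e_ge0 q t : 0 <= q%:R * s (X t) * (I t + sigma).
  by rewrite !mulr_ge0 ?(ltW (s0 _)) ?(ltW (Y0 _)).
have ie q : P.-integrable (X @^-1` B) (EFin \o e q).
  apply: bounded1_integrable => //; first exact: measurable_funTS.
  by move=> t; exact: expRN_ge0_le1.
transitivity (\int[P]_(t in X @^-1` B)
    (\sum_(q < n.+1) ('C(n, q)%:R * (-1) ^+ q)%:E * (e q t)%:E))%E.
  rewrite [RHS]integral_mkcond; apply: eq_integral => t _.
  rewrite patchE; case: ifPn => [/set_mem /= Bt|/negP nBt]; last first.
    rewrite (_ : _ @^-1` _ = set0) ?measure0//.
    apply/seteqP; split => // u; rewrite /xsection /= => /set_mem[/= Bt _].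
    by apply: nBt; exact/mem_set.
  rewrite (_ : _ @^-1` _ = [set u | h u < s (X t) * (I t + sigma) / alpha]); last first.
    apply/seteqP; split => u; rewrite /xsection /=; first by move=> /set_mem[].
    by move=> hu; apply/mem_set; split.
  rewrite (probability_lt_of_continuous_cdf _ _ _ _ _ (continuous_exp_cdf alpha n) _ hF)//; last first.
    by rewrite divr_gt0// mulr_gt0.
  under eq_bigr do rewrite -EFinM.
  rewrite sumEFin; congr EFin; rewrite exprBn; apply: eq_bigr => q _.
  rewrite expr1n mulr1 -mulr_natl mulrA; congr (_ * _).
  rewrite -expRM_natl /e; congr expR.
  by rewrite mulrN; congr (- _); field; rewrite lt0r_neq0.
rewrite (@integral_sum _ _ _ P _ mXB _ (fun (q : 'I_n.+1) t =>
  ('C(n, q)%:R * (-1) ^+ q)%:E * (e q t)%:E)%E); last first.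
  by move=> q; apply: integrableZl => //; exact: ie.
apply: eq_bigr => q _; rewrite (integralZl mXB (ie q)); congr (_ * _)%E.
(* The mixture lemma is used with [psi = q * s], which is nonnegative also at [q = 0]. *)
apply: (@laplace_mixture _ _ _ _ (measurableTypeR R) _ _ _ _ _ _ mD mX mY _ w0 iw hL) => //.
- by move=> t; exact: ltW.
- exact: measurable_funM.
- by move=> x; rewrite mulr_ge0// ltW.
Qed.

(** * Distances, thresholds and visibility angles *)

Lemma dist_k_gt0 {R : realType} (Re Rk x : R) : 0 < Re -> Re < Rk ->
  0 < dist_k Re Rk x.
Proof.
move=> Re0 ReRk; rewrite /dist_k sqrtr_gt0.
(* The squared distance is the squared difference of the radii plus a nonnegative term, hence
   positive even for a satellite at the zenith. *)
have -> : Re ^+ 2 + Rk ^+ 2 - 2 * Re * Rk * cos x =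
  (Rk - Re) ^+ 2 + 2 * Re * Rk * (1 - cos x) by ring.
have Rk0 := lt_trans Re0 ReRk.
apply: ltr_wpDr; last by rewrite exprn_gt0 ?subr_gt0.
by rewrite !mulr_ge0 ?subr_ge0 ?cos_le1// ltW.
Qed.

Lemma continuous_dist_k {R : realType} (Re Rk : R) : continuous (dist_k Re Rk).
Proof.
move=> x; apply: (@continuous_comp _ _ _
  (fun x => Re ^+ 2 + Rk ^+ 2 - 2 * Re * Rk * cos x) Num.sqrt);
  last exact: sqrt_continuous.
apply: cvgB; first exact: cvg_cst.
by apply: cvgMr; exact: continuous_cos.
Qed.

Lemma s_ES_gt0 {R : realType} (m1 : nat) (Re Rk m2 beta gamma Pt G c f x : R) :
  0 < Re -> Re < Rk -> 0 < m2 -> 0 < beta -> 0 < gamma - beta * (1 - gamma) ->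
  0 < Pt -> 0 < G -> 0 < c -> 0 < f ->
  0 < s_ES m1 Re Rk m2 beta gamma Pt G c f x.
Proof.
move=> Re0 ReRk m20 beta0 g0 Pt0 G0 c0 f0.
have d0 := dist_k_gt0 Re Rk x Re0 ReRk.
rewrite /s_ES; apply: mulr_gt0; last first.
  by rewrite exprn_gt0// divr_gt0// !mulr_gt0// pi_gt0.
apply: divr_gt0; last by rewrite !mulr_gt0.
by rewrite mulr_gt0// divr_gt0// powR_gt0// ltr0n fact_gt0.
Qed.

Lemma continuous_s_ES {R : realType} (m1 : nat) (Re Rk m2 beta gamma Pt G c f : R) :
  continuous (s_ES m1 Re Rk m2 beta gamma Pt G c f).
Proof.
move=> x; rewrite /s_ES; apply: cvgMr.
apply: (@continuous_comp _ _ _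
  (fun x => 4 * pi * f * dist_k Re Rk x / c) (fun y : R => y ^+ 2));
  last exact: exprn_continuous.
by apply: cvgMl; apply: cvgMr; exact: continuous_dist_k.
Qed.

(** After clearing the positive denominator the condition is linear in the fading power [u]. Its
    coefficient is a positive multiple of [gamma - beta * (1 - gamma)], so solving for [u] keeps the
    direction of the inequality. *)
Lemma ltr_SINR {R : realType} (m1 : nat)
  (Re Rk tb m2 beta gamma Pt G c f sigma2 x i u : R) :
  0 < Re -> Re < Rk -> 0 < m2 -> 0 < beta -> 0 < gamma <= 1 ->
  0 < gamma - beta * (1 - gamma) ->
  0 < Pt -> 0 < G -> 0 < c -> 0 < f -> 0 < sigma2 -> 0 <= i -> 0 <= u ->
  x < theta_max Re Rk tb ->
  (SINR Re Rk tb gamma Pt c f G sigma2 x i u < beta) =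
  (u < s_ES m1 Re Rk m2 beta gamma Pt G c f x * (i + sigma2) /
       ((m1`!%:R) `^ (- (m1%:R)^-1) / m2)).
Proof.
move=> Re0 ReRk m20 beta0 /andP[gamma0 gamma1] g0 Pt0 G0 c0 f0 sigma0 i0 u0 xm.
have d0 := dist_k_gt0 Re Rk x Re0 ReRk.
rewrite /SINR xm /Prec /s_ES.
set A := _ `^ _; have A0 : 0 < A by rewrite powR_gt0// ltr0n fact_gt0.
set d := dist_k _ _ _ in d0 *.
have e0 : 0 < 4 * pi * f by rewrite !mulr_gt0// pi_gt0.
move: (4 * pi * f) e0 => e e0.
set p := Pt * (c / (e * d)) ^+ 2 * G.
have p0 : 0 < p.
  by rewrite /p !mulr_gt0// ?invr_gt0// !mulr_gt0.
(* The rate [A / m2] cancels, and the path loss in [s_ES] is the inverse of the received power [p]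
   per unit of fading. *)
have -> : A / m2 * beta / ((gamma - beta * (1 - gamma)) * Pt * G) *
    (e * d / c) ^+ 2 * (i + sigma2) / (A / m2) =
    beta * (i + sigma2) / ((gamma - beta * (1 - gamma)) * p).
  by rewrite /p; field; rewrite !lt0r_neq0.
clearbody p.
rewrite [RHS]ltr_pdivlMr ?mulr_gt0//= ltr_pdivrMr; last first.
  by rewrite ltr_wpDl// addr_ge0// !mulr_ge0// ?subr_ge0// ltW.
rewrite -subr_gt0 -[RHS]subr_gt0; congr (0 < _); ring.
Qed.

(** For a narrow beam, [sin tb < Re / Rk] puts [Rk / Re * sin tb] strictly between [sin tb] and 1,
    so its arcsine exceeds [tb] and is at most [pi / 2]. Otherwise the angle is the arccosine of a
    number in []0, 1[]. *)
Lemma theta_max_itv {R : realType} (Re Rk tb : R) :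
  0 < Re -> Re < Rk -> 0 < tb < pi / 2 -> 0 <= theta_max Re Rk tb < pi.
Proof.
move=> Re0 ReRk /andP[tb0 tbpi].
have Rk0 : 0 < Rk := lt_trans Re0 ReRk.
have pi0 : 0 < pi :> R := pi_gt0 R.
have q01 : 0 < Re / Rk < 1 by rewrite divr_gt0//= ltr_pdivrMr// mul1r.
have /andP[q0 q1] := q01.
have tbin : tb \in `[- (pi / 2), pi / 2] by rewrite in_itv /=; lra.
rewrite /theta_max; case: ifPn => [tbq|_]; last first.
  by rewrite acos_ge0 ?acos_ltpi//=; lra.
have sin0 : 0 < sin tb by apply: sin_gt0_pihalf; rewrite tb0.
have qin : Re / Rk \in `[(-1), 1] by rewrite in_itv /=; lra.
have asinin : asin (Re / Rk) \in `[- (pi / 2), pi / 2].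
  by rewrite in_itv /= asin_geNpi2 ?asin_lepi2//; lra.
have sq : sin tb < Re / Rk by rewrite -(asinK qin) ltr_sin.
set y := Rk / Re * sin tb.
have y1 : y < 1.
  rewrite /y mulrC mulrA ltr_pdivrMr// mul1r; move: sq.
  by rewrite ltr_pdivlMr.
have ysin : sin tb < y.
  by rewrite /y -[ltLHS]mul1r ltr_pM2r// ltr_pdivlMr// mul1r.
have yin : y \in `[(-1), 1] by rewrite in_itv /=; lra.
have y11 : -1 <= y <= 1 by move: yin; rewrite in_itv.
have asinyin : asin y \in `[- (pi / 2), pi / 2].
  by rewrite in_itv /= asin_geNpi2 ?asin_lepi2.
have tby : tb < asin y by rewrite -ltr_sin// asinK.
have := asin_lepi2 y11; lra.
Qed.

(** With [x] the maximal angle this is the probability of an invisible satellite; the antiderivative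
    is [- cos y / 2]. *)
Lemma integral_sin_half {R : realType} (x : R) : x < pi ->
  Rintegral (@lebesgue_measure R) `[x, pi] (fun y => sin y / 2) =
  (1 + cos x) / 2.
Proof.
move=> xpi.
rewrite /Rintegral (@continuous_FTC2 _ _ (fun y => - cos y / 2))//.
- by rewrite -EFinB /= cospi; field.
- apply: continuous_subspaceT => y; apply: cvgMl; exact: continuous_sin.
- split.
  + by move=> y _; apply: ex_derive.
  + apply: cvg_at_right_filter; apply: cvgMl; apply: cvgN; exact: continuous_cos.
  + apply: cvg_at_left_filter; apply: cvgMl; apply: cvgN; exact: continuous_cos.
- move=> y _; rewrite derive1E.
  rewrite (_ : (fun y => _) = (fun y => 2^-1 *: - cos y)); last first.
    by apply/funext => z; rewrite mulrC.
  by rewrite derive_val; rewrite /GRing.scale /=; field.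
Qed.

(** * Outage probability of a single satellite *)

Lemma satellite_outage {R : realType} {d} {T : measurableType d}
  (P : probability T R) (Re Rk gamma Pt G c f sigma2 lambda_u m2 tb beta : R)
  (m1 : nat) (theta I h : T -> R) :
  0 < Re -> Re < Rk -> 0 < gamma <= 1 -> 0 < Pt -> 0 < G -> 0 < c -> 0 < f ->
  0 < sigma2 -> 0 < m2 -> 0 < tb < pi / 2 -> 0 < beta ->
  (gamma < 1 -> beta < gamma / (1 - gamma)) ->
  measurable_fun setT theta -> measurable_fun setT I -> measurable_fun setT h ->
  (forall A : set R, measurable A -> pr P (theta @^-1` A) =
     Rintegral (@lebesgue_measure R) (A `&` `[0, pi]) (fun x => sin x / 2)) ->
  (forall t, 0 <= h t) ->
  (forall x, 0 <= x -> pr P (h @^-1` `]-oo, x]) = Fh m1 m2 x) ->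
  indep_RV_pair P h theta I ->
  (forall t, 0 <= I t) ->
  (forall s, 0 <= s -> forall A : set R, measurable A ->
     Rintegral P (theta @^-1` A) (fun t => expR (- (s * I t))) =
     LapI m1 Re Rk tb lambda_u m2 Pt G c f s * pr P (theta @^-1` A)) ->
  pr P [set t | SINR Re Rk tb gamma Pt c f G sigma2 (theta t) (I t) (h t) < beta] =
  \sum_(q < m1.+1)
     'C(m1, q)%:R * (-1) ^+ q *
     Rintegral (@lebesgue_measure R) `[0, theta_max Re Rk tb]
       (fun th =>
          expR (- (q%:R * s_ES m1 Re Rk m2 beta gamma Pt G c f th * sigma2))
          * LapI m1 Re Rk tb lambda_u m2 Pt G c f
              (q%:R * s_ES m1 Re Rk m2 beta gamma Pt G c f th)
          * (sin th / 2))
   + (1 + cos (theta_max Re Rk tb)) / 2.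
Proof.
move=> Re0 ReRk gamma01 Pt0 G0 c0 f0 sigma0 m20 tb0 beta0 betalt mtheta mI mh
  htheta h0 hcdf hindep I0 hLap.
have g0 : 0 < gamma - beta * (1 - gamma).
  (* For [gamma = 1] the difference equals 1; otherwise its positivity is the bound [betalt]
     rearranged. *)
  case/andP: (gamma01) => gamma0; rewrite le_eqVlt => /predU1P[->|gamma1].
    by rewrite subrr mulr0 subr0.
  by rewrite subr_gt0 -ltr_pdivlMr ?subr_gt0// betalt.
have /andP[tm0 tmpi] := theta_max_itv Re Rk tb Re0 ReRk tb0.
set s := s_ES m1 Re Rk m2 beta gamma Pt G c f.
have s0 x : 0 < s x by exact: s_ES_gt0.
set tm := theta_max Re Rk tb in tm0 tmpi *.
set L := LapI _ _ _ _ _ _ _ _ _ _ in hLap *.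
pose alpha : R := (m1`!%:R) `^ (- (m1%:R)^-1) / m2.
have alpha0 : 0 < alpha by rewrite divr_gt0// powR_gt0// ltr0n fact_gt0.
pose w (x : R) : R := sin x / 2.
pose D : set R := `[0, pi]%classic.
pose B : set R := `]-oo, tm[%classic.
have mD : measurable D by exact: measurable_itv.
have mB : measurable B by exact: measurable_itv.
have w0 x : D x -> 0 <= w x.
  by rewrite /D /= in_itv => xpi; rewrite divr_ge0// sin_ge0_pi.
have iw : (@lebesgue_measure R).-integrable D (EFin \o w).
  apply: continuous_compact_integrable; first exact: segment_compact.
  by apply: continuous_subspaceT => x; apply: cvgMl; exact: continuous_sin.
have mw : measurable_fun D w by case/integrableP : (iw) => /measurable_EFinP.
have iwA A : measurable A -> (@lebesgue_measure R).-integrable (A `&` D) (EFin \o w).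
  by move=> mA; apply: integrableS iw => //; exact: measurableI.
have mtA A : measurable A -> measurable (theta @^-1` A).
  by move=> mA; rewrite -[X in measurable X]setTI; exact: mtheta.
pose Y t := I t + sigma2.
have Y0 t : 0 <= Y t by rewrite addr_ge0// ltW.
have mY : measurable_fun setT Y by exact: measurable_funD.
(* The noise is deterministic, so it contributes the factor [expR (- (r * sigma2))]. *)
have shift A r : measurable A -> 0 <= r ->
    Rintegral P (theta @^-1` A) (fun t => expR (- (r * Y t))) =
    expR (- (r * sigma2)) * L r * pr P (theta @^-1` A).
  move=> mA r0; rewrite -mulrA -hLap// -RintegralZl; [|exact: mtA|].
    apply: eq_Rintegral => t _; rewrite -expRD; congr expR.
    by rewrite /Y mulrDr opprD addrC.
  apply: bounded1_integrable; first exact: mtA.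
    by apply: measurable_expRN; exact: measurable_funM.
  by move=> t; rewrite expRN_ge0_le1// mulr_ge0.
(* Conditioning on the sure event turns the conditional formula into the plain Laplace transform. *)
have lapY r : 0 <= r -> laplace P Y r = expR (- (r * sigma2)) * L r.
  move=> r0; rewrite /laplace -(preimage_setT theta) shift//.
  by rewrite preimage_setT /pr probability_setT mulr1.
have hL r A : 0 <= r -> measurable A ->
    (\int[P]_(t in theta @^-1` A) (expR (- (r * Y t)))%:E =
     (laplace P Y r)%:E * \int[lebesgue_measure]_(x in A `&` D) (w x)%:E)%E.
  move=> r0 mA.
  have -> : (\int[lebesgue_measure]_(x in A `&` D) (w x)%:E)%E =
      (pr P (theta @^-1` A))%:E.
    rewrite htheta// /Rintegral fineK//; apply: integrable_fin_num.
      exact: measurableI.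
    exact: iwA.
  rewrite -EFinM lapY// -shift// /Rintegral fineK//; apply: integrable_fin_num.
    exact: mtA.
  apply: bounded1_integrable; first exact: mtA.
    by apply: measurable_expRN; exact: measurable_funM.
  by move=> t; rewrite expRN_ge0_le1// mulr_ge0.
have ms : measurable_fun setT s.
  by apply: continuous_measurable_fun; exact: continuous_s_ES.
have := fading_outage P h theta I lebesgue_measure D B w s alpha sigma2 m1
  mh mtheta mI hindep alpha0 sigma0 I0 hcdf mD w0 iw hL ms s0 mB.
set E2 := [set t | _] => PE2.
(* The outage event [E] splits into [E1], where the satellite is invisible, and [E2], where it is
   visible and the fading is too weak. *)
pose E1 := theta @^-1` `[tm, +oo[%classic.
have mE1 : measurable E1 by exact: mtA.
set E := [set t | _].
have mE2 : measurable E2.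
  have -> : E2 = theta @^-1` B `&`
      (fun t => h t < s (theta t) * (I t + sigma2) / alpha) @^-1` [set true].
    by apply/seteqP; split.
  apply: measurableI; first exact: mtA.
  rewrite -[X in measurable X]setTI; apply: measurable_fun_ltr => //.
  apply: measurable_funM => //; apply: measurable_funM => //.
  exact: measurableT_comp.
have EE2 : E `\` E1 = E2.
  apply/seteqP; split => t.
    rewrite /E1 /= in_itv /= andbT => -[Et /negP]; rewrite -ltNge => ttm.
    split; first by rewrite /B /= in_itv.
    by move: Et; rewrite /E /= (ltr_SINR m1 Re Rk tb m2).
  move=> [Bt Et]; have ttm : theta t < tm by move: Bt; rewrite /B /= in_itv.
  split; first by rewrite /E /= (ltr_SINR m1 Re Rk tb m2).
  by rewrite /E1 /= in_itv /= andbT => /le_lt_trans/(_ ttm); rewrite ltxx.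
(* An invisible satellite has SINR 0, which is below the positive [beta]. *)
have E1E : E1 `<=` E.
  move=> t; rewrite /E1 /E /= in_itv /= andbT => tmt.
  have /negbTE nt : ~~ (theta t < tm) by rewrite -leNgt.
  by rewrite /SINR -/tm nt.
have -> : E = E2 `|` E1 by rewrite -EE2 setUC setDUK.
rewrite /pr measureU//; last by rewrite -EE2 setDE -setIA setICl setI0.
rewrite fineD ?fin_num_measure//; congr (_ + _); last first.
  rewrite -[LHS]/(pr P E1) htheta// -integral_sin_half//; congr Rintegral.
  apply/seteqP; split => x /=; rewrite !in_itv /= andbT.
    by move=> [-> /andP[]].
  by move=> /andP[tmx ->]; rewrite tmx (le_trans tm0).
rewrite -[LHS]/(fine (P E2)) PE2.
pose gq (q : nat) x := laplace P Y (q%:R * s x) * w x.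
have igq q : (@lebesgue_measure R).-integrable D (EFin \o gq q).
  apply: le_integrable iw => //.
    apply/measurable_EFinP; apply: measurable_funM; last exact: mw.
    apply: measurable_funTS; apply: measurable_laplace_comp => //.
      exact: measurable_funM.
    by move=> x; rewrite mulr_ge0// ltW.
  move=> x Dx; rewrite /= lee_fin normrM ger0_norm ?laplace_ge0//.
  by rewrite ler_piMl// laplace_le1// mulr_ge0// ltW.
(* Since [tm < pi], the visible angles fill the whole of [[0, tm[] inside the support of the
   density. *)
have BD : B `&` D = `[0, tm[%classic.
  apply/seteqP; split => x; rewrite /B /D /= !in_itv /=.
    by move=> [-> /andP[->]].
  by move=> /andP[-> xtm]; rewrite xtm (ltW (lt_trans xtm tmpi)).
have igB q : (@lebesgue_measure R).-integrable `[0, tm[%classic (EFin \o gq q).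
  by apply: integrableS (igq q) => //; rewrite -BD => x [].
rewrite BD; transitivity (fine (\sum_(q < m1.+1) ('C(m1, q)%:R * (-1) ^+ q *
    Rintegral lebesgue_measure `[0, tm[ (gq q))%:E)).
  congr fine; apply: eq_bigr => q _; rewrite [RHS]EFinM; congr (_ * _)%E.
  by rewrite /Rintegral fineK//; apply: integrable_fin_num => //; exact: igB.
rewrite sumEFin /=; apply: eq_bigr => q _; congr (_ * _).
(* Visibility is a strict inequality, whereas the formula integrates up to [tm] included; the
   endpoint is a null set. *)
rewrite Rintegral_itv_bndo_bndc; last exact: igB.
apply: eq_Rintegral => x _.
by rewrite /gq lapY// mulr_ge0// ltW.
Qed.

(** * The product over all eavesdropping satellites *)

Lemma mutually_independent_mem {R : realType} {d} {T : measurableType d}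
  (P : probability T R) (K : nat) (N : 'I_K -> nat) (m : 'I_K)
  (E : 'I_K * nat -> set T) :
  mutually_independent P
    (fun kj : 'I_K * nat => kj.1 != m /\ (kj.2 < N kj.1)%N) E ->
  pr P [set t | forall k : 'I_K, k != m -> forall j, (j < N k)%N -> E (k, j) t]
  = \prod_(k < K | k != m) \prod_(j < N k) pr P (E (k, j : nat)).
Proof.
move=> ind.
(* A duplicate-free list of the eavesdropping satellites, to which mutual independence applies; the
   range of [j] depends on the tier [k]. *)
pose s := [seq (k, j) | k <- [seq k <- enum 'I_K | k != m], j <- iota 0 (N k)].
have sP k j : ((k, j) \in s) = (k != m) && (j < N k)%N.
  apply/idP/andP => [/allpairsPdep[k' [j' [k'm j'N [-> ->]]]]|[km jN]].
    by move: k'm j'N; rewrite mem_filter mem_iota => /andP[].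
  apply/allpairsPdep; exists k, j; split => //.
    by rewrite mem_filter km mem_enum.
  by rewrite mem_iota.
have -> : [set t | forall k : 'I_K, k != m -> forall j, (j < N k)%N -> E (k, j) t]
    = \big[setI/setT]_(kj <- s) E kj.
  rewrite -bigcap_seq; apply/seteqP; split => t.
    by move=> Et [k j] /=; rewrite sP => /andP[km jN]; exact: Et.
  by move=> Et k km j jN; apply: Et; rewrite /= sP km.
rewrite ind; last first.
- by move=> [k j]; rewrite sP => /andP[].
- apply: allpairs_uniq_dep.
  + by rewrite filter_uniq// enum_uniq.
  + by move=> k _; exact: iota_uniq.
  + by move=> [k j] [k' j'] _ _ /= [-> ->].
rewrite big_allpairs_dep big_filter big_enum_cond /=; apply: eq_bigr => k _.
by rewrite -[X in iota _ X]subn0 -/(index_iota 0 (N k)) big_mkord.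
Qed.

(** The maximum of finitely many SINRs is below [beta] exactly when each of them is, and the event
    is expressed in this form. The conditional Laplace transform given the angle is encoded by
    integrals over the events that the angle lies in [A]. *)
Theorem theorem1 (R : realType) (d : measure_display) (T : measurableType d)
  (P : probability T R)
  (K : nat) (m : 'I_K) (N : 'I_K -> nat)
  (Re : R) (a : 'I_K -> R)
  (gamma Pt G c f sigma2 lambda_u m2 theta_beam beta : R) (m1 : nat)
  (theta I h : 'I_K -> nat -> T -> R)
  (* standing assumptions on the parameters *)
  (hRe : 0 < Re) (ha : forall k, 0 < a k)
  (hgamma : 0 < gamma <= 1) (hPt : 0 < Pt) (hG : 0 < G) (hc : 0 < c)
  (hf : 0 < f) (hsigma : 0 < sigma2) (hlambda : 0 < lambda_u)
  (hm1 : (0 < m1)%N) (hm2 : 0 < m2)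
  (hbeam : 0 < theta_beam < pi / 2)
  (hbeta : 0 < beta) (hbeta' : gamma < 1 -> beta < gamma / (1 - gamma))
  (* random variables *)
  (mtheta : forall k j, measurable_fun setT (theta k j))
  (mI : forall k j, measurable_fun setT (I k j))
  (mh : forall k j, measurable_fun setT (h k j))
  (* uniform placement: central angle has density sin/2 on [0, pi] *)
  (htheta : forall k j, k != m -> (j < N k)%N -> forall A : set R, measurable A ->
     pr P (theta k j @^-1` A) =
     Rintegral (@lebesgue_measure R) (A `&` `[0, pi]) (fun x => sin x / 2))
  (* |h|^2 : nonnegative, CDF F, independent of (theta, I) *)
  (hh0 : forall k j t, 0 <= h k j t)
  (hcdf : forall k j, k != m -> (j < N k)%N -> forall x, 0 <= x ->
     pr P (h k j @^-1` `]-oo, x]) = Fh m1 m2 x)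
  (hindep : forall k j, k != m -> (j < N k)%N ->
     indep_RV_pair P (h k j) (theta k j) (I k j))
  (* interference: nonnegative, conditional Laplace transform given theta *)
  (hI0 : forall k j t, 0 <= I k j t)
  (hLap : forall k j, k != m -> (j < N k)%N -> forall s, 0 <= s ->
     forall A : set R, measurable A ->
     Rintegral P (theta k j @^-1` A) (fun t => expR (- (s * I k j t))) =
     LapI m1 Re (Re + a k) theta_beam lambda_u m2 Pt G c f s
       * pr P (theta k j @^-1` A))
  (* mutual independence of the events {SINR_kj < beta} *)
  (hmut : mutually_independent P
     (fun kj : 'I_K * nat => kj.1 != m /\ (kj.2 < N kj.1)%N)
     (fun kj => [set t | SINR Re (Re + a kj.1) theta_beam gamma Pt c f G sigma2
                  (theta kj.1 kj.2 t) (I kj.1 kj.2 t) (h kj.1 kj.2 t) < beta])) :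
  pr P [set t | forall k : 'I_K, k != m -> forall j, (j < N k)%N ->
          SINR Re (Re + a k) theta_beam gamma Pt c f G sigma2
            (theta k j t) (I k j t) (h k j t) < beta]
  = \prod_(k < K | k != m)
      (\sum_(q < m1.+1)
         'C(m1, q)%:R * (-1) ^+ q *
         Rintegral (@lebesgue_measure R) `[0, theta_max Re (Re + a k) theta_beam]
           (fun th =>
              expR (- (q%:R * s_ES m1 Re (Re + a k) m2 beta gamma Pt G c f th * sigma2))
              * LapI m1 Re (Re + a k) theta_beam lambda_u m2 Pt G c f
                  (q%:R * s_ES m1 Re (Re + a k) m2 beta gamma Pt G c f th)
              * (sin th / 2))
       + (1 + cos (theta_max Re (Re + a k) theta_beam)) / 2) ^+ N k.
Proof.
rewrite (mutually_independent_mem P K N m _ hmut) /=; apply: eq_bigr => k km.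
(* All satellites of a tier have the same outage probability, so the power [N k] is a product of
   [N k] equal factors. *)
rewrite -[X in _ = _ ^+ X]card_ord -prodr_const; apply: eq_bigr => j _.
have jN := ltn_ord j.
by apply: (satellite_outage P Re (Re + a k) gamma Pt G c f sigma2 lambda_u m2
  theta_beam beta m1 (theta k j) (I k j) (h k j)) => //;
  [rewrite ltrDl|exact: htheta|exact: hcdf|exact: hindep|exact: hLap].
Qed.
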